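(* Let $B$ be a finite graph without half-loops and let $\phi:\psi\to B$ be an étale morphism from a finite graph $\psi$; let $r=\mathrm{ord}(\psi)$. Then for large $n$, $$\mathbb E_{G\in\mathcal C_n(B)}[\mathrm{NumOccurs}(\phi,G)]=n^{-r}+O(n^{-r-1}),$$ and hence $\Pr_{G\in\mathcal C_n(B)}[\phi\text{ occurs in }G]\le n^{-r}+O(n^{-r-1})$. Furthermore, if $\psi$ is pruned and each connected component of $\psi$ has order at least one, then for large $n$ the probability that $\phi$ occurs at least once in $G\in\mathcal C_n(B)$ equals $n^{-r}/c+O(n^{-r-1})$, where $c=|\mathrm{Aut}(\phi)|$.
   Context: Graphs are finite with multiple edges and whole-loops allowed, no half-loops; $\mathrm{ord}(\psi)=|E_\psi|-|V_\psi|$; pruned means every vertex has degree at least two. A morphism is étale if it is injective on directed edges with a given tail and on those with a given head. $\mathcal C_n(B)$: random cover $\pi:G\to B$ with vertices $V_B\times[n]$ from independent uniform $\sigma(e)\in S_n$ per undirected edge ($\sigma(e^{-1})=\sigma(e)^{-1}$), the edge over $e$ from $(t(e),i)$ to $(h(e),\sigma(e)i)$. For $\phi:\psi\to B$, $\mathrm{NumOccurs}(\phi,G)$ is the number of injective graph morphisms $\nu:\psi\to G$ with $\pi\circ\nu=\phi$; $\phi$ occurs in $G$ if this number is positive. $\mathrm{Aut}(\phi)$ is the group of graph automorphisms $\nu$ of $\psi$ with $\phi\circ\nu=\phi$. *)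

(* Defs.v *)
From mathcomp Require Import all_boot all_order all_algebra all_fingroup.
Set Implicit Arguments. Unset Strict Implicit. Unset Printing Implicit Defensive.
Import GRing.Theory Num.Theory.

(* A finite graph (multiple edges and whole-loops allowed, no half-loops),
   in the dart model: gD = directed edges, ginv = reversal (fixed-point free,
   i.e. no half-loops), gtl = tail.  Each undirected edge = one ginv-orbit
   {d, ginv d}. *)
Record graph := Graph {
  gV : finType;
  gD : finType;
  gtl : gD -> gV;
  ginv : gD -> gD;
  ginvK : involutive ginv;
  ginv_nofix : forall d, ginv d != d }.

Definition ghd (G : graph) (d : gD G) : gV G := gtl (ginv d).

(* |E| - |V| ; |E| = #darts / 2 *)
Definition ord (G : graph) : int := (#|gD G| %/ 2)%:Z - #|gV G|%:Z.

Definition is_morph (G H : graph) (fV : gV G -> gV H) (fD : gD G -> gD H) : bool :=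
  [forall d, fV (gtl d) == gtl (fD d)] && [forall d, fD (ginv d) == ginv (fD d)].

Definition etale (G H : graph) (fD : gD G -> gD H) : bool :=
  [forall d1, forall d2, ((gtl d1 == gtl d2) && (fD d1 == fD d2)) ==> (d1 == d2)] &&
  [forall d1, forall d2, ((ghd d1 == ghd d2) && (fD d1 == fD d2)) ==> (d1 == d2)].

(* pruned: every vertex has degree >= 2 (a whole-loop contributes 2) *)
Definition pruned (G : graph) : bool :=
  [forall v, 2 <= #|[set d : gD G | gtl d == v]|].

Definition adj (G : graph) : rel (gV G) :=
  [rel u w | [exists d : gD G, (gtl d == u) && (ghd d == w)]].

Definition comp (G : graph) (v : gV G) : {set gV G} := [set u | connect (@adj G) v u].

Definition comp_ord (G : graph) (v : gV G) : int :=
  (#|[set d : gD G | gtl d \in comp v]| %/ 2)%:Z - #|comp v|%:Z.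

(* Random n-covers: one permutation per undirected edge, encoded as a
   function on darts with sigma(e^{-1}) = sigma(e)^{-1}.  Such consistent
   assignments are in bijection with independent choices of one permutation
   per undirected edge, so the uniform measure on [assign B n] is C_n(B). *)
Definition consistent (B : graph) (n : nat) (s : {ffun gD B -> {perm 'I_n}}) : bool :=
  [forall e, s (ginv e) == (s e)^-1%g].

Definition assign (B : graph) (n : nat) :=
  {s : {ffun gD B -> {perm 'I_n}} | consistent s}.

Section Cover.
Variables (B : graph) (n : nat) (s : assign B n).

Definition cov_tl (x : (gD B * 'I_n)%type) : (gV B * 'I_n)%type := (gtl x.1, x.2).
Definition cov_inv (x : (gD B * 'I_n)%type) : (gD B * 'I_n)%type :=
  (ginv x.1, (val s x.1) x.2).

Lemma cov_invK : involutive cov_inv.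
Proof.
case=> e i; rewrite /cov_inv /= ginvK.
have /forallP/(_ e)/eqP -> := valP s.
by rewrite permK.
Qed.

Lemma cov_inv_nofix x : cov_inv x != x.
Proof.
case: x => e i; rewrite /cov_inv xpair_eqE negb_and.
by rewrite ginv_nofix.
Qed.

(* the cover G: vertices V_B x [n]; the dart over e at level i goes from
   (t(e), i) to (h(e), sigma(e) i). *)
Definition cover : graph := @Graph (gV B * 'I_n)%type (gD B * 'I_n)%type
  cov_tl cov_inv cov_invK cov_inv_nofix.

End Cover.

Definition NumOccurs (psi B G : graph) (phiV : gV psi -> gV B) (phiD : gD psi -> gD B)
    (piV : gV G -> gV B) (piD : gD G -> gD B) : nat :=
  #|[set p : {ffun gV psi -> gV G} * {ffun gD psi -> gD G} |
      [&& is_morph p.1 p.2, injectiveb p.1, injectiveb p.2,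
          [forall v, piV (p.1 v) == phiV v] & [forall d, piD (p.2 d) == phiD d]]]|.

Definition NumOccursCov (psi B : graph) (phiV : gV psi -> gV B) (phiD : gD psi -> gD B)
    (n : nat) (s : assign B n) : nat :=
  NumOccurs phiV phiD (G := cover s) fst fst.

(* |Aut(phi)|: automorphisms nu of psi (morphisms bijective on vertices and darts;
   for finite types injective = bijective) with phi o nu = phi *)
Definition aut_card (psi B : graph) (phiV : gV psi -> gV B) (phiD : gD psi -> gD B) : nat :=
  #|[set p : {ffun gV psi -> gV psi} * {ffun gD psi -> gD psi} |
      [&& is_morph p.1 p.2, injectiveb p.1, injectiveb p.2,
          [forall v, phiV (p.1 v) == phiV v] & [forall d, phiD (p.2 d) == phiD d]]]|.

Local Open Scope ring_scope.

Definition expect_occ (psi B : graph) (phiV : gV psi -> gV B) (phiD : gD psi -> gD B)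
    (n : nat) : rat :=
  (\sum_(s : assign B n) (NumOccursCov phiV phiD s)%:R) / #|{: assign B n}|%:R.

Definition prob_occurs (psi B : graph) (phiV : gV psi -> gV B) (phiD : gD psi -> gD B)
    (n : nat) : rat :=
  #|[set s : assign B n | (0 < NumOccursCov phiV phiD s)%N]|%:R / #|{: assign B n}|%:R.

(* Main.v *)
Require Import Defs.
From mathcomp Require Import all_boot all_order all_algebra all_fingroup.
From mathcomp Require Import zify lra.
Set Implicit Arguments. Unset Strict Implicit. Unset Printing Implicit Defensive.
Import Order.TTheory GRing.Theory Num.Theory.

(* An occurrence of [phi] in the cover is determined by the labels [a v] in [n] of
   the vertices of [psi]; it prescribes one value of a permutation per edge, so for
   [K] edges a given labelling occurs with probability between [n^-K] and
   [(n-K)^-K].  About [n^|V|] labellings are injective on fibres, which gives the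
   expectation, and Markov's inequality gives the bound on the probability.

   In the pruned case [Aut(phi)] acts freely on the [N] occurrences, and
   [|[N > 0] - N/c| <= N (N - c)], the number of pairs of occurrences in distinct
   orbits.  Two such occurrences have different images.  Degrees at least two and
   component orders at least one force each proper subgraph of [psi] to have
   order at most [r - 1], so the union of the images has order at least [r + 1],
   and the expected number of such pairs is [O(n^(-r-1))]. *)

(** * Fixed-point-free involutions and their two-element orbits *)

Section FreeInvolution.
Variables (T : finType) (f : T -> T).
Hypotheses (fK : involutive f) (f_nofix : forall x, f x != x).

(** The enumeration order selects one point from each orbit [{x, f x}]; for [ginv] this is one dart
    per undirected edge. *)
Definition orientation : {set T} := [set x | enum_rank x < enum_rank (f x)].

Lemma orientation_inv x : (f x \in orientation) = (x \notin orientation).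
Proof.
rewrite !inE fK -leqNgt ltn_neqAle andb_idl // => _.
by rewrite (inj_eq val_inj) (inj_eq enum_rank_inj).
Qed.

Lemma sum_orientation (h : T -> nat) : (forall x, h (f x) = h x) ->
  \sum_x h x = (\sum_(x in orientation) h x).*2.
Proof.
move=> hf; rewrite (bigID [in orientation]) /= -addnn; congr addn.
rewrite (reindex_inj (inv_inj fK)) /=.
by apply: eq_big => [x|x _] //; rewrite orientation_inv negbK.
Qed.

Lemma card_involution_closed (S : {set T}) :
  (forall x, (f x \in S) = (x \in S)) -> #|S| = #|S :&: orientation|.*2.
Proof.
move=> Sf; rewrite -!sum1_card big_mkcond /=.
rewrite (sum_orientation (h := fun x => if x \in S then 1 else 0)); last first.
  by move=> x; rewrite Sf.
congr double; rewrite -big_mkcondr /=; apply: eq_bigl => x.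
by rewrite in_setI andbC.
Qed.

End FreeInvolution.

(** * Permutations with prescribed values *)

Section PermCount.
Variable T : finType.
Implicit Types (F : {set T * T}) (p : {perm T}).

Definition perm_sat F : pred {perm T} := fun p => [forall x in F, p x.1 == x.2].

(** Induction on the lists: a permutation that is right on the tails is followed by a transposition
    that corrects the head and fixes every point of the tail of [t]. *)
Lemma uniq_perm_map (s t : seq T) : uniq s -> uniq t -> size s = size t ->
  exists p : {perm T}, map p s = t.
Proof.
elim: s t => [|x s IH] [|y t] //=; first by exists 1%g.
move=> /andP[xs us] /andP[yt ut] [/(IH _ us ut)[p pE]].
have pxt : p x \notin t by rewrite -pE (mem_map perm_inj).
exists (p * tperm (p x) y)%g; rewrite permM tpermL; congr cons.
rewrite -[RHS]pE; apply/eq_in_map => z zs.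
have zt : p z \in t by rewrite -pE map_f.
rewrite permM tpermD //; last by apply: contraNneq yt => ->.
by apply: contraNneq pxt => ->.
Qed.

Lemma perm_sat_ex F : {in F &, injective fst} -> {in F &, injective snd} ->
  exists p, perm_sat F p.
Proof.
move=> i1 i2; case: (@uniq_perm_map [seq x.1 | x <- enum F] [seq x.2 | x <- enum F]).
- by rewrite map_inj_in_uniq ?enum_uniq // => x y; rewrite !mem_enum; apply: i1.
- by rewrite map_inj_in_uniq ?enum_uniq // => x y; rewrite !mem_enum; apply: i2.
- by rewrite !size_map.
move=> p; rewrite -map_comp => /eq_in_map pE; exists p.
by apply/forall_inP => x xF; apply/eqP/pE; rewrite mem_enum.
Qed.

(** Every solution is [q * p0] for a unique [q] fixing all first coordinates of [F], so the
    solutions are as many as the permutations of the remaining points. *)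
Lemma card_perm_sat F p0 : perm_sat F p0 -> #|perm_sat F| = (#|T| - #|F|)`!.
Proof.
move=> /forall_inP p0F; set A := [set x.1 | x in F].
have cA : #|A| = #|F|.
  apply: card_in_imset => x y xF yF exy.
  have := eqP (p0F _ xF); have := eqP (p0F _ yF); rewrite exy => -> e.
  by case: x y exy e {xF yF} => [? ?] [? ?] /= -> ->.
have -> : #|T| - #|F| = #|~: A| by rewrite [RHS]cardsCs setCK cA.
rewrite -card_perm.
rewrite -[RHS](card_imset _ (mulIg p0)); apply: eq_card => p.
rewrite [LHS]unfold_in; apply/forall_inP/imsetP.
  move=> pF; exists (p * p0^-1)%g; last by rewrite mulgKV.
  rewrite unfold_in; apply/subsetP => x; rewrite inE permM => h; rewrite inE.
  apply: contra h => /imsetP[y yF ->].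
  by rewrite (eqP (pF _ yF)) -(eqP (p0F _ yF)) permK.
case=> q qA -> x xF; rewrite permM (out_perm qA) ?p0F //.
by rewrite inE negbK imset_f.
Qed.

End PermCount.

(** * Falling factorials and the number of covers with prescribed arcs *)

Lemma ffact_le_exp m k : m ^_ k <= m ^ k.
Proof.
by elim: k => // k IH; rewrite ffactnSr expnSr leq_mul ?leq_subr.
Qed.

Lemma exp_le_ffact m k l : k <= l -> (m - l) ^ k <= m ^_ k.
Proof.
elim: k => // k IH kl; rewrite ffactnSr expnSr.
by apply: leq_mul; [apply: IH (ltnW kl) | apply: leq_sub2l (ltnW kl)].
Qed.

Section AssignCount.
Variables (B : graph) (n : nat).
Notation O := (orientation (@ginv B)).

Lemma assignV (s : assign B n) e : val s (ginv e) = (val s e)^-1%g.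
Proof. by have /forallP/(_ e)/eqP := valP s. Qed.

Lemma orientation_ginv (e : gD B) : (ginv e \in O) = (e \notin O).
Proof. exact: orientation_inv (@ginvK B) (@ginv_nofix B) e. Qed.

(** The values on [O] can be chosen freely and determine the assignment by inversion; the
    compatibility of [P] with inversion carries each constraint over to the opposite dart. *)
Lemma card_assign_family (P : gD B -> pred {perm 'I_n}) :
  (forall e p, P (ginv e) p^-1%g = P e p) ->
  #|[set s : assign B n | [forall e, P e (val s e)]]| = \prod_(e in O) #|P e|.
Proof.
move=> PV.
(* The value [1] off [O] is the default that [pfamily] expects. *)
pose g (s : assign B n) := [ffun e => if e \in O then val s e else 1%g].
have g_inj : injective g.
  move=> s t /ffunP gst; apply: val_inj; apply/ffunP => e.
  have gO e' : e' \in O -> val s e' = val t e'.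
    by move=> eO; have := gst e'; rewrite !ffunE eO.
  have [/gO //|eO] := boolP (e \in O).
  by apply: invg_inj; rewrite -!assignV gO // orientation_ginv.
rewrite -(card_imset _ g_inj).
transitivity #|pfamily (1%g : {perm 'I_n}) (mem O) P|.
  apply: eq_card => q; apply/imsetP/pfamilyP.
    case=> s; rewrite inE => /forallP sP ->; split.
      by apply/subsetP => e; rewrite unfold_in ffunE; case: ifP => //; rewrite eqxx.
    by move=> e eO; rewrite ffunE eO; apply: sP.
  case=> /supportP q1 qP.
  pose t := [ffun e => if e \in O then q e else (q (ginv e))^-1%g].
  have tc : consistent t.
    apply/forallP => e; rewrite !ffunE orientation_ginv ginvK.
    by case: (e \in O) => //=; rewrite invgK.
  exists (Sub t tc : assign B n).
    rewrite inE; apply/forallP => e; rewrite SubK ffunE.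
    case: ifPn => [/qP //|eO]; rewrite -PV invgK.
    by apply: qP; rewrite orientation_ginv.
  apply/ffunP => e; rewrite ffunE SubK ffunE.
  by case: ifPn => eO; [rewrite eO | rewrite q1].
by rewrite card_pfamily foldrE big_map big_enum.
Qed.

Lemma card_assign : #|{: assign B n}| = \prod_(e in O) n`!.
Proof.
transitivity #|[set s : assign B n | [forall e, predT (val s e)]]|.
  by apply: eq_card => s; rewrite !inE; symmetry; apply/forallP.
rewrite (card_assign_family (P := fun=> predT)) //.
by apply: eq_bigr => e _; rewrite -card_Sn; apply: eq_card.
Qed.

(** A triple [(e, (i, j))] encodes the demand that the permutation over [e] send [i] to [j]. Its
    reversal is the equivalent demand over [ginv e], so a reversal-closed [F] carries [#|F|./2]
    undirected demands. *)
Definition dart_rev (x : gD B * ('I_n * 'I_n)) := (ginv x.1, (x.2.2, x.2.1)).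

Definition fibre (F : {set gD B * ('I_n * 'I_n)}) e := [set ij | (e, ij) \in F].

Definition assign_sat (F : {set gD B * ('I_n * 'I_n)}) : {set assign B n} :=
  [set s : assign B n | [forall x in F, val s x.1 x.2.1 == x.2.2]].

Section Closed.
Variable F : {set gD B * ('I_n * 'I_n)}.
Hypothesis F_rev : forall x, (dart_rev x \in F) = (x \in F).
Let K := #|F|./2.

Lemma card_fibre_ginv e : #|fibre F (ginv e)| = #|fibre F e|.
Proof.
have swap_inj : injective (fun ij : 'I_n * 'I_n => (ij.2, ij.1)).
  by case=> [? ?] [? ?] [-> ->].
rewrite -[RHS](card_imset _ swap_inj); apply: eq_card => -[i j].
apply/idP/imsetP => [h | [[k l] + [-> ->]]].
  by exists (j, i) => //; move: h; rewrite !inE -F_rev /dart_rev /= ginvK.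
by rewrite !inE -F_rev.
Qed.

Lemma sum_fibre : \sum_(e in O) #|fibre F e| = K.
Proof.
rewrite /K -[LHS]doubleK -(sum_orientation (@ginvK B) (@ginv_nofix B)).
  congr half; rewrite -sum1_card [RHS]big_mkcond /=.
  transitivity (\sum_e \sum_ij if (e, ij) \in F then 1 else 0).
    apply: eq_bigr => e _; rewrite -sum1_card big_mkcond.
    by apply: eq_bigr => ij; rewrite inE.
  by rewrite pair_bigA; apply: eq_bigr => -[].
by move=> e; rewrite card_fibre_ginv.
Qed.

Hypothesis F_perm : forall e, exists p, perm_sat (fibre F e) p.

Lemma card_assign_sat : #|assign_sat F| = \prod_(e in O) (n - #|fibre F e|)`!.
Proof.
have PV e p : perm_sat (fibre F (ginv e)) p^-1%g = perm_sat (fibre F e) p.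
  apply/forall_inP/forall_inP => h [i j]; rewrite inE /= => ijF.
    have /= := h (j, i); rewrite inE -F_rev /dart_rev /= ginvK => /(_ ijF) /eqP <-.
    by rewrite permKV.
  have /= := h (j, i); rewrite inE -F_rev /dart_rev /= => /(_ ijF) /eqP <-.
  by rewrite permK.
transitivity #|[set s : assign B n | [forall e, perm_sat (fibre F e) (val s e)]]|.
  apply: eq_card => s; rewrite !inE; apply/forall_inP/forallP => h.
    by move=> e; apply/forall_inP => ij; rewrite inE => /h.
  by case=> e ij eF; have /forall_inP /(_ ij) := h e; rewrite inE; apply.
rewrite (card_assign_family (P := fun e => perm_sat (fibre F e))) //; apply: eq_bigr => e _.
by have [p /card_perm_sat ->] := F_perm e; rewrite card_ord.
Qed.

Lemma fibre_le e : #|fibre F e| <= n.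
Proof.
have [p /forall_inP pF] := F_perm e; rewrite -[n in _ <= n]card_ord.
have : #|fst @: fibre F e| <= #|'I_n| by apply: max_card.
rewrite card_in_imset // => x y xF yF exy.
have := eqP (pF _ xF); have := eqP (pF _ yF); rewrite exy => -> e'.
by case: x y exy e' {xF yF} => [? ?] [? ?] /= -> ->.
Qed.

Lemma fibre_leK e : #|fibre F e| <= K.
Proof.
wlog eO : e / e \in O.
  move=> W; have [/W //|eO] := boolP (e \in O).
  by rewrite -card_fibre_ginv W // orientation_ginv.
by rewrite -sum_fibre (bigD1 e) //= leq_addr.
Qed.

(** For a fibre of size [f <= K], each factor satisfies [n! = n ^_ f * (n - f)!] and
    [(n - K) ^ f <= n ^_ f]; the sizes [f] over [O] add up to [K]. *)
Lemma card_assign_sat_le : #|assign_sat F| * (n - K) ^ K <= #|{: assign B n}|.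
Proof.
rewrite card_assign_sat card_assign -{2}sum_fibre expn_sum -big_split /=.
apply: leq_prod => e _; rewrite mulnC -(ffact_fact (fibre_le e)).
by rewrite leq_mul // exp_le_ffact // fibre_leK.
Qed.

Lemma card_assign_sat_ge : #|{: assign B n}| <= #|assign_sat F| * n ^ K.
Proof.
rewrite card_assign_sat card_assign -sum_fibre expn_sum -big_split /=.
apply: leq_prod => e _; rewrite mulnC -(ffact_fact (fibre_le e)).
by rewrite leq_mul // ffact_le_exp.
Qed.

End Closed.
End AssignCount.

(** * Subgraphs of pruned graphs *)

Section GraphFacts.
Variable G : graph.

Lemma card_dart_closed (Y : {set gD G}) :
  (forall d, (ginv d \in Y) = (d \in Y)) -> ~~ odd #|Y|.
Proof.
move=> YV; rewrite (card_involution_closed (@ginvK G) (@ginv_nofix G)) //.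
by rewrite odd_double.
Qed.

Lemma card_darts_even : ~~ odd #|gD G|.
Proof. by rewrite -cardsT card_dart_closed // => d; rewrite !inE. Qed.

Lemma pruned_card_star (X : {set gV G}) : pruned G ->
  2 * #|X| <= #|[set d : gD G | gtl d \in X]|.
Proof.
move=> /forallP G2; rewrite -sum1_card mul2n -addnn -!sum1_card -big_split /=.
rewrite (partition_big (@gtl G) [in X]) /=; last by move=> d; rewrite inE.
apply: leq_sum => v vX; apply: leq_trans (G2 v) _.
rewrite -sum1_card; apply: eq_leq; apply: eq_bigl => d.
by rewrite !inE andb_idl // => /eqP ->.
Qed.

(* [X] and [Y] are the complements of the vertex and dart sets of a subgraph. *)
Lemma proper_subgraph_ord (X : {set gV G}) (Y : {set gD G}) :
  pruned G -> (forall v : gV G, (1 <= comp_ord v)%R) ->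
  (forall d, (ginv d \in Y) = (d \in Y)) ->
  (forall d, gtl d \in X -> d \in Y) ->
  (X != set0) || (Y != set0) -> 2 * #|X| + 2 <= #|Y|.
Proof.
move=> prG ordG YV XY neq0; set DX := [set d : gD G | gtl d \in X].
have DXY : DX \subset Y by apply/subsetP => d; rewrite inE => /XY.
have le1 := pruned_card_star X prG; have le2 := subset_leq_card DXY.
have evY := card_dart_closed YV.
(* If the bound fails, evenness of [#|Y|] and the degree bound leave only [#|Y| = 2 * #|X|], so [Y]
   is exactly the set of darts with tail in [X]. *)
case: (ltnP #|Y| (2 * #|X| + 2)) => // ltY; exfalso.
have eqY : #|Y| = 2 * #|X| by rewrite -/DX in le1; lia.
have DXE : DX = Y by apply/eqP; rewrite eqEcard DXY eqY.
have : X != set0.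
  by apply: contraTneq neq0 => X0; rewrite X0 eqxx -cards_eq0 eqY X0 cards0.
case/set0Pn => v vX.
(* As [Y] is closed under reversal, [X] is a union of components. *)
have compX : Defs.comp v \subset X.
  apply/subsetP => u; rewrite inE => /connectP[p]; elim: p v vX => [|w p IH] v vX /=.
    by move=> _ ->.
  case/andP => /existsP[d /andP[/eqP dv /eqP dw]]; apply: IH.
  by rewrite -dw; have := YV d; rewrite -DXE !inE -/(ghd d) dv vX.
have := ordG v; rewrite /comp_ord; set DC := [set d | _ \in Defs.comp v] => ordv.
(* The vertices of [X] outside the component of [v] already use two darts each, so this component
   has at most two darts per vertex, against its order being at least one. *)
have le3 := pruned_card_star (X :\: Defs.comp v) prG.
have : #|DX| = #|DC| + #|[set d : gD G | gtl d \in X :\: Defs.comp v]|.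
  rewrite -(cardsID DC DX); congr addn; apply: eq_card => d; rewrite !inE //.
  rewrite andb_idl // => dc; apply: (subsetP compX); by rewrite inE.
have cXC := cardsID (Defs.comp v) X; rewrite (setIidPr compX) in cXC.
rewrite DXE; lia.
Qed.

End GraphFacts.

(** * Two embedded copies of a graph *)

Lemma card_union_codom (S T : finType) (f g : S -> T) :
  injective f -> injective g ->
  #|[set f x | x : S] :|: [set g x | x : S]| =
  #|S| + #|[set x | g x \notin [set f x | x : S]]|.
Proof.
move=> fi gi; set A := [set f x | x : S]; set X := [set x | _].
have -> : A :|: [set g x | x : S] = A :|: [set g x | x in X].
  apply/setP => y; rewrite !in_setU; case: (boolP (y \in A)) => //= yA.
  apply/imsetP/imsetP => -[x]; last by exists x.
  by move=> _ yE; exists x; rewrite // inE -yE.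
rewrite cardsU (_ : _ :&: _ = set0) ?cards0 ?subn0.
  by rewrite !card_imset //.
apply/setP => y; rewrite !inE; apply/negP => /andP[yA /imsetP[x + yE]].
by rewrite inE -yE yA.
Qed.

Section Overlap.
Variables psi G : graph.
Variables (fV fV' : gV psi -> gV G) (fD fD' : gD psi -> gD G).
Hypotheses (fM : is_morph fV fD) (gM : is_morph fV' fD').
Hypotheses (fVi : injective fV) (gVi : injective fV').
Hypotheses (fDi : injective fD) (gDi : injective fD').

(** Twice the inequality saying that the union of two copies has order at least [ord psi + 1]. What
    the second copy adds to the first is the complement in [psi] of the subgraph sent into the first
    copy, and that subgraph is proper. *)
Lemma overlap_ord :
  pruned psi -> (forall v : gV psi, (1 <= comp_ord v)%R) ->
  ~ ((forall v, exists w, fV' v = fV w) /\ (forall d, exists e, fD' d = fD e)) ->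
  2 * #|[set fV v | v : gV psi] :|: [set fV' v | v : gV psi]| + #|gD psi| + 2
  <= #|[set fD d | d : gD psi] :|: [set fD' d | d : gD psi]| + 2 * #|gV psi|.
Proof.
case/andP: fM => /forallP ft /forallP fi; case/andP: gM => /forallP gt /forallP gi.
move=> pr ordp ncov; rewrite !card_union_codom //.
set X := [set v | _]; set Y := [set d | _].
suff : 2 * #|X| + 2 <= #|Y| by lia.
have Ydir d : d \in Y -> ginv d \in Y.
  rewrite !inE; apply: contra => /imsetP[e _ dE]; apply/imsetP.
  by exists (ginv e) => //; rewrite (eqP (fi e)) -dE (eqP (gi d)) ginvK.
apply: proper_subgraph_ord => //.
- by move=> d; apply/idP/idP => /Ydir //; rewrite ginvK.
- move=> d; rewrite !inE; apply: contra => /imsetP[e _ dE]; apply/imsetP.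
  by exists (gtl e) => //; rewrite (eqP (gt d)) dE (eqP (ft e)).
rewrite -negb_and; apply/negP => /andP[/eqP X0 /eqP Y0]; apply: ncov.
split=> [v|d].
  have := in_set0 v; rewrite -X0 inE => /negbFE/imsetP[w _ ->]; by exists w.
have := in_set0 d; rewrite -Y0 inE => /negbFE/imsetP[w _ ->]; by exists w.
Qed.

End Overlap.

(** * Occurrences as vertex labellings, and the action of automorphisms *)

Section Occurrences.
Variables (B psi : graph) (phiV : gV psi -> gV B) (phiD : gD psi -> gD B).
Hypotheses (Hmorph : is_morph phiV phiD) (Het : etale phiD).

Lemma phi_tl d : phiV (gtl d) = gtl (phiD d).
Proof. by case/andP: Hmorph => /forallP/(_ d)/eqP. Qed.

Lemma phi_inv d : phiD (ginv d) = ginv (phiD d).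
Proof. by case/andP: Hmorph => _ /forallP/(_ d)/eqP. Qed.

Lemma etale_tl_inj d1 d2 : gtl d1 = gtl d2 -> phiD d1 = phiD d2 -> d1 = d2.
Proof.
case/andP: Het => /forallP/(_ d1)/forallP/(_ d2) /implyP h _ e1 e2.
by apply/eqP/h; rewrite e1 e2 !eqxx.
Qed.

Definition Auts : {set {ffun gV psi -> gV psi} * {ffun gD psi -> gD psi}} :=
  [set p : {ffun gV psi -> gV psi} * {ffun gD psi -> gD psi} |
      [&& is_morph p.1 p.2, injectiveb p.1, injectiveb p.2,
          [forall v, phiV (p.1 v) == phiV v] & [forall d, phiD (p.2 d) == phiD d]]].

Variant auts_spec (p : {ffun gV psi -> gV psi} * {ffun gD psi -> gD psi}) : Prop :=
  AutsSpec of (forall d, p.1 (gtl d) = gtl (p.2 d))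
    & (forall d, p.2 (ginv d) = ginv (p.2 d))
    & injective p.1 & injective p.2
    & (forall v, phiV (p.1 v) = phiV v) & (forall d, phiD (p.2 d) = phiD d).

Lemma AutsP p : reflect (auts_spec p) (p \in Auts).
Proof.
rewrite inE; apply: (iffP idP).
  case/and5P => /andP[/forallP m1 /forallP m2] /injectiveP i1 /injectiveP i2.
  by move=> /forallP f1 /forallP f2; split=> // x; apply/eqP.
case=> m1 m2 i1 i2 f1 f2; apply/and5P; split; try exact/injectiveP.
- by apply/andP; split; apply/forallP => d; apply/eqP.
- by apply/forallP => v; apply/eqP.
by apply/forallP => v; apply/eqP.
Qed.

Lemma aut_card_gt0 : 0 < aut_card phiV phiD.
Proof.
apply/card_gt0P; exists ([ffun v => v], [ffun d => d]).
by apply/AutsP; split=> [d|d|x y|x y|v|d] /=; rewrite ?ffunE.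
Qed.

Section Labels.
Variable n : nat.
Implicit Types (a : {ffun gV psi -> 'I_n}) (s : assign B n).

Definition liftV a v : gV B * 'I_n := (phiV v, a v).
(** A dart of the cover carries the level of its tail, so the labels of the vertices fix the dart
    map as well. *)
Definition liftD a d : gD B * 'I_n := (phiD d, a (gtl d)).
Definition arcs a : {set gD B * ('I_n * 'I_n)} :=
  [set (phiD d, (a (gtl d), a (ghd d))) | d : gD psi].
Definition valid a := injectiveb (liftV a).
Definition occ s a := valid a && (s \in assign_sat (arcs a)).
Definition relabel a (p : {ffun gV psi -> gV psi} * {ffun gD psi -> gD psi}) :=
  [ffun v => a (p.1 v)].
Definition aut_orbit a : {set {ffun gV psi -> 'I_n}} :=
  [set relabel a p | p in Auts].

Lemma satP s a :
  reflect (forall d, val s (phiD d) (a (gtl d)) = a (ghd d)) (s \in assign_sat (arcs a)).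
Proof.
rewrite inE; apply: (iffP forall_inP) => [h d|h x /imsetP[d _ ->]].
  by apply/eqP/(h (phiD d, (a (gtl d), a (ghd d)))); apply: imset_f.
by rewrite /= h.
Qed.

Lemma arcs_rev a x : (dart_rev x \in arcs a) = (x \in arcs a).
Proof.
have D y : y \in arcs a -> dart_rev y \in arcs a.
  case/imsetP => d _ ->; apply/imsetP; exists (ginv d) => //.
  by rewrite /dart_rev /= phi_inv /ghd ginvK.
apply/idP/idP => /D //; case: x => e [i j]; by rewrite /dart_rev /= ginvK.
Qed.

(** Darts with equal lifts have tails with equal image and label, hence equal tails by validity, and
    then étaleness at the tail applies. *)
Lemma liftD_inj a : valid a -> injective (liftD a).
Proof.
move/injectiveP => va d1 d2 [e1 e2]; apply: etale_tl_inj => //.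
by apply: va; rewrite /liftV e2 !phi_tl e1.
Qed.

Lemma arc_inj a : valid a -> injective (fun d => (phiD d, (a (gtl d), a (ghd d)))).
Proof.
by move=> va d1 d2 [e1 e2 _]; apply: (liftD_inj va); rewrite /liftD e1 e2.
Qed.

Lemma card_arcs a : valid a -> #|arcs a| = #|gD psi|.
Proof. by move=> va; rewrite card_imset //; apply: arc_inj. Qed.

(** The pairs prescribed over [e] form a partial injection: equal starting labels are settled by
    [liftD_inj], equal end labels by the same lemma applied to the reversed darts. *)
Lemma arcs_perm a e : valid a -> exists p, perm_sat (fibre (arcs a) e) p.
Proof.
move=> va; apply: perm_sat_ex => -[i j] [i' j']; rewrite !inE.
  move=> /imsetP[d _ [-> -> ->]] /imsetP[d' _ [ed -> ->]] /= ea.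
  suff -> : d = d' by [].
  by apply: (liftD_inj va); rewrite /liftD ed ea.
move=> /imsetP[d _ [-> -> ->]] /imsetP[d' _ [ed -> ->]] /= ea.
suff -> : d = d' by [].
apply: (inv_inj (@ginvK psi)); apply: (liftD_inj va).
by rewrite /liftD !phi_inv ed -!/(ghd _) ea.
Qed.

Lemma cover_morph s a : s \in assign_sat (arcs a) ->
  @is_morph psi (Defs.cover s) (liftV a) (liftD a).
Proof.
move=> /satP sa; apply/andP; split; apply/forallP => d; apply/eqP.
  by rewrite /liftV phi_tl.
by rewrite /liftD /= /cov_inv /= phi_inv sa.
Qed.

Lemma NumOccursCovE s : NumOccursCov phiV phiD s = #|[set a | occ s a]|.
Proof.
pose g a : {ffun gV psi -> gV (Defs.cover s)} * {ffun gD psi -> gD (Defs.cover s)} :=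
  ([ffun v => liftV a v], [ffun d => liftD a d]).
have g_inj : injective g.
  by move=> a b [/ffunP h _]; apply/ffunP => v; have := h v; rewrite !ffunE => -[].
rewrite -[RHS](card_imset _ g_inj); apply: eq_card => -[pV pD].
rewrite inE; apply/idP/imsetP => /=.
  case/and5P => /andP[/forallP m1 /forallP m2] /injectiveP i1 /injectiveP i2.
  move=> /forallP f1 /forallP f2.
  pose a := [ffun v => (pV v).2].
  have aV v : pV v = liftV a v.
    by rewrite /liftV ffunE -(eqP (f1 v)); case: (pV v).
  have aD d : pD d = liftD a d.
    have := eqP (m1 d); rewrite aV /liftD -(eqP (f2 d)) /=.
    by case: (pD d) => e i [_ ->].
  exists a; last by congr pair; apply/ffunP => x; rewrite ffunE ?aV ?aD.
  rewrite inE; apply/andP; split.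
    by apply/injectiveP => v w; rewrite -!aV; apply: i1.
  apply/satP => d; have := eqP (m2 d); rewrite !aD /liftD /= /cov_inv /=.
  by case.
case=> a; rewrite inE => /andP[va sa] [-> ->]; apply/and5P; split.
- case/andP: (cover_morph sa) => /forallP m1 /forallP m2.
  by apply/andP; split; apply/forallP => d; rewrite !ffunE ?m1 ?m2.
- by apply/injectiveP => v w; rewrite !ffunE; apply/injectiveP: v w.
- by apply/injectiveP => v w; rewrite !ffunE; apply: liftD_inj.
- by apply/forallP => v; rewrite ffunE.
by apply/forallP => v; rewrite ffunE.
Qed.

Lemma occ_aut_orbit s a b : occ s a -> b \in aut_orbit a -> occ s b.
Proof.
case/andP=> /injectiveP va /satP sa /imsetP[p /AutsP[m1 m2 i1 i2 f1 f2] ->].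
apply/andP; split.
  apply/injectiveP => v w; rewrite /liftV !ffunE => -[e1 e2]; apply/i1/va.
  by rewrite /liftV !f1 e1 e2.
apply/satP => d; rewrite !ffunE m1 -f2 sa; congr (a _).
by rewrite /ghd -m2 m1.
Qed.

(** The action is free: validity recovers the vertex map of an automorphism from the relabelling,
    and étaleness then recovers its dart map. *)
Lemma card_aut_orbit a : valid a -> #|aut_orbit a| = aut_card phiV phiD.
Proof.
move=> /injectiveP va; rewrite card_in_imset //.
move=> p q /AutsP[m1 _ _ _ f1 f2] /AutsP[n1 _ _ _ g1 g2] /ffunP epq.
have eV v : p.1 v = q.1 v.
  by apply: va; have := epq v; rewrite /liftV !ffunE => ->; rewrite f1 g1.
have eD d : p.2 d = q.2 d.
  by apply: etale_tl_inj; rewrite -?m1 -?n1 ?eV // f2 g2.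
by case: p q {epq m1 f1 f2 n1 g1 g2} eV eD => pV pD [qV qD] /= /ffunP -> /ffunP ->.
Qed.

Definition verts2 a b := [set liftV a v | v : gV psi] :|: [set liftV b v | v : gV psi].

Lemma occ_overlap s a b : pruned psi -> (forall v : gV psi, (1 <= comp_ord v)%R) ->
  occ s a -> occ s b -> b \notin aut_orbit a ->
  2 * #|verts2 a b| + #|gD psi| + 2 <= #|arcs a :|: arcs b| + 2 * #|gV psi|.
Proof.
move=> pr op /andP[va sa] /andP[vb sb] nab.
(* Dropping the end label turns an arc into a dart of the cover; nothing is lost, because [s]
   determines that label. *)
pose h (x : gD B * ('I_n * 'I_n)) := (x.1, x.2.1).
have hI : {in arcs a :|: arcs b &, injective h}.
  have hE x : x \in arcs a :|: arcs b -> val s x.1 x.2.1 = x.2.2.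
    by rewrite inE => /orP[] xF; apply/eqP; [move: sa|move: sb];
       rewrite inE => /forall_inP; apply.
  move=> [e [i j]] [e' [i' j']] /hE /= xE /hE /= yE [eE iE].
  by rewrite -xE -yE eE iE.
rewrite -(card_in_imset hI) imsetU.
have hA c : h @: arcs c = [set liftD c d | d : gD psi].
  by rewrite /arcs -imset_comp; apply: eq_imset.
rewrite !hA; apply: (overlap_ord (cover_morph sa) (cover_morph sb)) => //;
  try exact: liftD_inj; try exact/injectiveP.
(* If the copy given by [b] lies inside the one given by [a], pulling it back along the latter
   yields an automorphism [p] with [b = relabel a p]. *)
case=> hV hD; case/negP: nab.
have exV v : exists w, liftV b v == liftV a w by have [w ->] := hV v; exists w.
have exD v : exists w, liftD b v == liftD a w by have [w ->] := hD v; exists w.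
pose p := ([ffun v => xchoose (exV v)], [ffun d => xchoose (exD d)]).
have pV v : liftV b v = liftV a (p.1 v) by rewrite ffunE; apply/eqP/(xchooseP (exV v)).
have pD d : liftD b d = liftD a (p.2 d) by rewrite ffunE; apply/eqP/(xchooseP (exD d)).
apply/imsetP; exists p; last first.
  by apply/ffunP => v; rewrite ffunE; case: (pV v).
have f1 v : phiV (p.1 v) = phiV v by case: (pV v).
have f2 d : phiD (p.2 d) = phiD d by case: (pD d).
have tl d : p.1 (gtl d) = gtl (p.2 d).
  move/injectiveP: va; apply; rewrite -pV /liftV !phi_tl f2.
  by case: (pD d) => _ ->.
apply/AutsP; split=> //.
- move=> d; apply: (liftD_inj va); rewrite -pD /liftD !phi_inv f2; congr pair.
  move/satP: sb => /(_ d); rewrite /ghd => <-; move/satP: sa => /(_ (p.2 d)).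
  by rewrite /ghd => <-; rewrite f2; case: (pD d) => _ ->.
- by move=> v w e; move/injectiveP: vb; apply; rewrite !pV e.
by move=> v w e; apply: (liftD_inj vb); rewrite !pD e.
Qed.

Lemma card_valid_le : #|[set a | valid a]| <= n ^ #|gV psi|.
Proof. by apply: leq_trans (max_card _) _; rewrite card_ffun card_ord. Qed.

Lemma card_valid_ge : n ^_ #|gV psi| <= #|[set a | valid a]|.
Proof.
rewrite -[n in n ^_ _]card_ord -card_inj_ffuns; apply: subset_leq_card.
apply/subsetP => a; rewrite !inE => /injectiveP ia; apply/injectiveP => v w [_].
exact: ia.
Qed.

Lemma sum_NumOccurs :
  \sum_(s : assign B n) NumOccursCov phiV phiD s =
  \sum_(a in [set a | valid a]) #|assign_sat (arcs a)|.
Proof.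
transitivity (\sum_(s : assign B n) \sum_(a in [set a | occ s a]) 1).
  by apply: eq_bigr => s _; rewrite NumOccursCovE sum1_card.
rewrite (exchange_big_dep [in [set a | valid a]]) /=; last first.
  by move=> s a _; rewrite !inE => /andP[].
apply: eq_bigr => a; rewrite inE => va; rewrite -sum1_card; apply: eq_bigl => s.
by rewrite [LHS]inE /occ va.
Qed.

End Labels.
End Occurrences.

Local Open Scope ring_scope.

(** * Numerical estimates *)

(** Bernoulli's inequality for [1 - l / n], multiplied by [n ^ k]. *)
Lemma exp_natr_sub_ge (n k l : nat) : (0 < n)%N -> (l <= n)%N ->
  n%:R ^+ k * (1 - (k * l)%:R / n%:R) <= (n - l)%:R ^+ k :> rat.
Proof.
move=> n0 ln; have n0' : 0 < n%:R :> rat by rewrite ltr0n.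
elim: k => [|k IH]; first by rewrite mul0n mul0r subr0 !expr0 mulr1.
have le1 : l%:R / n%:R <= 1 :> rat by rewrite ler_pdivrMr // mul1r ler_nat.
have ge0 : 0 <= l%:R / n%:R :> rat by rewrite divr_ge0 ?ler0n.
have kge0 : 0 <= k%:R :> rat by rewrite ler0n.
have E : (n - l)%:R = n%:R * (1 - l%:R / n%:R) :> rat.
  by rewrite natrB // mulrBr mulr1 mulrCA divff ?mulr1 ?gt_eqF.
rewrite (exprSr (n - l)%:R); apply: le_trans (ler_wpM2r (ler0n _ _) IH).
rewrite E mulrACA -exprSr ler_wpM2l ?exprn_ge0 ?ler0n //.
rewrite -addn1 mulnDl mul1n natrD natrM mulrDl -mulrA.
by move: (l%:R / n%:R) ge0 le1 => x; nra.
Qed.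

(** With [y = K ^ 2 / n <= 1 / 2], the Bernoulli bound loses a factor [1 - y], and [(1 + 2 * y) * (1
    - y) = 1 + y * (1 - 2 * y) >= 1]. *)
Lemma exp_natr_le_sub (n K : nat) : (0 < n)%N -> (2 * K ^ 2 <= n)%N ->
  n%:R ^+ K <= (1 + (2 * K ^ 2)%:R / n%:R) * (n - K)%:R ^+ K :> rat.
Proof.
move=> n0 Kn; have Kln : (K <= n)%N by nia.
have n0' : 0 < n%:R :> rat by rewrite ltr0n.
have := exp_natr_sub_ge K n0 Kln; rewrite mulnn natrM.
have y0 : 0 <= (K ^ 2)%:R / n%:R :> rat by rewrite divr_ge0 ?ler0n.
have y1 : 2 * ((K ^ 2)%:R / n%:R) <= 1 :> rat.
  by rewrite mulrA ler_pdivrMr // mul1r -natrM ler_nat.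
rewrite -[2%:R * _ / _]mulrA; move: ((K ^ 2)%:R / n%:R) y0 y1 => y y0 y1.
have x0 : 0 <= n%:R ^+ K :> rat by rewrite exprn_ge0 ?ler0n.
move: (n%:R ^+ K) ((n - K)%:R ^+ K) x0 => x z x0 h.
have h' : (1 + 2 * y) * (x * (1 - y)) <= (1 + 2 * y) * z by rewrite ler_wpM2l //; lra.
have xy : 0 <= x * (y * (1 - 2 * y)) by rewrite !mulr_ge0 //; lra.
by apply: le_trans h'; nra.
Qed.

(* Group the [x] by the map [rho x] sending each index to a chosen index with
   the same image point: [x] is then determined by [l x] on the range of [rho x]. *)
Lemma sum_image_weight (I T X : finType) (n : nat) (g : I -> T) (l : X -> I -> 'I_n) :
  (0 < n)%N -> (forall x y, l x =1 l y -> x = y) ->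
  \sum_x n%:R ^- #|[set (g i, l x i) | i : I]| <= (#|I| ^ #|I|)%:R :> rat.
Proof.
move=> n0 l_inj; pose L x i := (g i, l x i).
(* The default [i] is never reached, since [i] itself satisfies the predicate. *)
pose rho x : {ffun I -> I} := [ffun i => odflt i [pick j | L x j == L x i]].
have rhoE x i : L x (rho x i) = L x i.
  by rewrite ffunE; case: pickP => [j /eqP //|_].
have rho_eq x i j : L x i = L x j -> rho x i = rho x j.
  move=> e; rewrite !ffunE (eq_pick (Q := fun k => L x k == L x j)).
    by case: pickP => // /(_ j); rewrite eqxx.
  by move=> k; rewrite /= e.
have card_rho x : #|[set L x i | i : I]| = #|[set rho x i | i : I]|.
  have -> : [set L x i | i : I] = L x @: [set rho x i | i : I].
    by rewrite -imset_comp; apply: eq_imset => i; rewrite /= rhoE.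
  rewrite card_in_imset // => _ _ /imsetP[i _ ->] /imsetP[j _ ->].
  by rewrite !rhoE; apply: rho_eq.
(* There are [#|I| ^ #|I|] possible maps [r], and the class of each contributes at most 1: at most
   [n ^ #|S|] elements of weight [n ^- #|S|]. *)
rewrite (partition_big rho xpredT) //= -card_ffun -sum1_card natr_sum.
rewrite [leRHS](eq_bigl xpredT) //; apply: ler_sum => r _.
pose S := [set r i | i : I].
rewrite (eq_bigr (fun=> n%:R ^- #|S|)); last first.
  by move=> x /eqP rx; rewrite -/(L x) card_rho rx.
rewrite sumr_const -[_ *+ _]mulr_natr mulrC ler_pdivrMr ?exprn_gt0 ?ltr0n //.
rewrite mul1r -natrX ler_nat.
pose h x : {ffun {i | i \in S} -> 'I_n} := [ffun i => l x (val i)].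
have h_inj : {in [pred x | rho x == r] &, injective h}.
  move=> x y /eqP rx /eqP ry /ffunP hxy; apply: l_inj => i.
  have rS : r i \in S by apply: imset_f.
  have := hxy (Sub (r i) rS); rewrite !ffunE /= -{1}rx -ry => e.
  by case: (rhoE x i) (rhoE y i) => _ <- [_ <-].
rewrite -(card_in_imset h_inj); apply: leq_trans (max_card _) _.
by rewrite card_ffun card_ord card_sig.
Qed.

(** * Probability that prescribed arcs are present *)

Section SatRatio.
Variables (B : graph) (n : nat) (F : {set gD B * ('I_n * 'I_n)}).
Hypothesis F_rev : forall x, (dart_rev x \in F) = (x \in F).
Hypothesis F_perm : forall e, exists p, perm_sat (fibre F e) p.
Let K := #|F|./2.

Lemma card_assign_gt0 : (0 < #|{: assign B n}|)%N.
Proof. by rewrite card_assign prodn_gt0 // => e; apply: fact_gt0. Qed.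

Lemma sat_ratio_ge : (0 < n)%N ->
  n%:R ^- K <= #|assign_sat F|%:R / #|{: assign B n}|%:R :> rat.
Proof.
move=> n0; have A0 : 0 < #|{: assign B n}|%:R :> rat by rewrite ltr0n card_assign_gt0.
rewrite ler_pdivlMr // mulrC ler_pdivrMr ?exprn_gt0 ?ltr0n //.
by rewrite -natrX -natrM ler_nat card_assign_sat_ge.
Qed.

Lemma sat_ratio_le : (0 < n)%N -> (2 * K ^ 2 <= n)%N ->
  #|assign_sat F|%:R / #|{: assign B n}|%:R <= (1 + (2 * K ^ 2)%:R / n%:R) * n%:R ^- K :> rat.
Proof.
move=> n0 Kn; have A0 : 0 < #|{: assign B n}|%:R :> rat by rewrite ltr0n card_assign_gt0.
set q := _ / _; have q0 : 0 <= q by rewrite divr_ge0 ?ler0n.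
have q1 : q * (n - K)%:R ^+ K <= 1.
  rewrite /q mulrAC ler_pdivrMr // mul1r -natrX -natrM ler_nat.
  exact: card_assign_sat_le.
rewrite ler_pdivlMr ?exprn_gt0 ?ltr0n //.
apply: le_trans (ler_wpM2l q0 (exp_natr_le_sub n0 Kn)) _.
rewrite mulrCA -[leRHS]mulr1 ler_wpM2l //.
by rewrite addr_ge0 ?divr_ge0 ?ler0n.
Qed.

End SatRatio.

(** * First and second moments of the number of occurrences *)

Section Moments.
Variables (B psi : graph) (phiV : gV psi -> gV B) (phiD : gD psi -> gD B).
Hypotheses (Hmorph : is_morph phiV phiD) (Het : etale phiD).
Let v := #|gV psi|.
Let K := #|gD psi|./2.
Let c := aut_card phiV phiD.

Lemma ordE : ord psi = K%:Z - v%:Z.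
Proof. by rewrite /ord divn2. Qed.

Lemma exprz_ord n : (0 < n)%N ->
  n%:R ^ (- ord psi) = n%:R ^+ v / n%:R ^+ K :> rat.
Proof.
move=> n0; have nz : n%:R != 0 :> rat by rewrite pnatr_eq0 -lt0n.
by rewrite ordE opprB expfzDr // -exprnN.
Qed.

Lemma exprz_ordS n : (0 < n)%N ->
  n%:R ^ (- ord psi - 1) = n%:R ^ (- ord psi) / n%:R :> rat.
Proof.
move=> n0; have nz : n%:R != 0 :> rat by rewrite pnatr_eq0 -lt0n.
by rewrite expfzDr // exprN1.
Qed.

Lemma expect_occE n : expect_occ phiV phiD n =
  \sum_(a in [set a | valid phiV (n := n) a])
     #|assign_sat (arcs phiD a)|%:R / #|{: assign B n}|%:R.
Proof. by rewrite /expect_occ -natr_sum sum_NumOccurs // natr_sum mulr_suml. Qed.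

Lemma expect_occ_bounds n : (0 < n)%N -> (2 * K ^ 2 <= n)%N -> (v <= n)%N ->
  n%:R ^ (- ord psi) * (1 - (v * v)%:R / n%:R) <= expect_occ phiV phiD n
    <= n%:R ^ (- ord psi) * (1 + (2 * K ^ 2)%:R / n%:R).
Proof.
move=> n0 Kn vn; rewrite expect_occE exprz_ord //.
have nK0 : 0 < n%:R ^+ K :> rat by rewrite exprn_gt0 ?ltr0n.
have cK a : valid phiV (n := n) a -> #|arcs phiD a|./2 = K.
  by move=> va; rewrite (card_arcs Hmorph).
apply/andP; split.
  (* Lower bound: at least [n ^_ v >= (n - v) ^ v] valid labellings, each of probability at least
     [n ^- K]. *)
  apply: (@le_trans _ _ (\sum_(a in [set a | valid phiV (n := n) a]) n%:R ^- K)).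
    rewrite sumr_const -[leRHS]mulr_natl mulrAC ler_wpM2r ?invr_ge0 ?(ltW nK0) //.
    apply: le_trans (exp_natr_sub_ge _ n0 vn) _; rewrite -natrX ler_nat.
    by apply: leq_trans (card_valid_ge phiV n); apply: exp_le_ffact.
  apply: ler_sum => a; rewrite inE => va; rewrite -(cK a va).
  by apply: sat_ratio_ge => // [x|e]; [apply: (arcs_rev Hmorph) | apply: (arcs_perm Hmorph Het)].
apply: (@le_trans _ _ (\sum_(a in [set a | valid phiV (n := n) a])
    (1 + (2 * K ^ 2)%:R / n%:R) * n%:R ^- K)).
  apply: ler_sum => a; rewrite inE => va; rewrite -(cK a va).
  apply: sat_ratio_le => // [x|e|]; [exact: (arcs_rev Hmorph) | exact: (arcs_perm Hmorph Het) |].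
  by rewrite cK.
rewrite sumr_const -[leLHS]mulr_natl mulrA mulrAC ler_wpM2r //.
  by rewrite addr_ge0 ?divr_ge0 ?ler0n.
by rewrite ler_wpM2r ?invr_ge0 ?(ltW nK0) // -natrX ler_nat card_valid_le.
Qed.

Lemma expect_occ_asymp n : (0 < n)%N -> (2 * K ^ 2 <= n)%N -> (v <= n)%N ->
  `|expect_occ phiV phiD n - n%:R ^ (- ord psi)|
    <= (v * v + 2 * K ^ 2)%:R * n%:R ^ (- ord psi - 1).
Proof.
move=> n0 Kn vn; case/andP: (expect_occ_bounds n0 Kn vn).
rewrite exprz_ordS //; set x := n%:R ^ _; set E := expect_occ _ _ _.
have x0 : 0 <= x by rewrite exprz_ge0 ?ler0n.
have y0 : 0 <= x / n%:R by rewrite divr_ge0 ?ler0n.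
rewrite natrD mulrBr mulrDr mulr1 ![x * (_ / _)]mulrCA.
have := mulr_ge0 (ler0n rat (v * v)) y0.
have := mulr_ge0 (ler0n rat (2 * K ^ 2)) y0.
rewrite mulrDl ler_norml; lra.
Qed.

Lemma prob_le_expect n : prob_occurs phiV phiD n <= expect_occ phiV phiD n.
Proof.
rewrite /prob_occurs /expect_occ ler_wpM2r ?invr_ge0 ?ler0n //.
rewrite -natr_sum ler_nat -sum1_card big_mkcond /=; apply: leq_sum => s _.
by rewrite inE; case: (NumOccursCov _ _ _).
Qed.

Definition distinct_pairs n (s : assign B n) : nat :=
  \sum_(ab : {ffun gV psi -> 'I_n} * {ffun gV psi -> 'I_n})
    [&& occ phiV phiD s ab.1, occ phiV phiD s ab.2 & ab.2 \notin aut_orbit phiV phiD ab.1].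

(** The orbit of an occurrence consists of [c] occurrences, which leaves [N - c] partners for each
    of the [N]. *)
Lemma distinct_pairsE n (s : assign B n) :
  distinct_pairs s = (NumOccursCov phiV phiD s * (NumOccursCov phiV phiD s - c))%N.
Proof.
rewrite /distinct_pairs -(pair_bigA _ (fun a b => nat_of_bool
  [&& occ phiV phiD s a, occ phiV phiD s b & b \notin aut_orbit phiV phiD a])) /=.
rewrite NumOccursCovE // -sum_nat_const [RHS]big_mkcond /=; apply: eq_bigr => a _.
rewrite [in RHS]inE; case: (boolP (occ _ _ _ _)) => /= [oa|]; last by rewrite big1.
have oS : aut_orbit phiV phiD a \subset [set b | occ phiV phiD s b].
  by apply/subsetP => b; rewrite inE; apply: occ_aut_orbit.
rewrite /c -(card_aut_orbit Het (a := a)); last by case/andP: oa.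
have := cardsD [set b | occ phiV phiD s b] (aut_orbit phiV phiD a).
rewrite (setIidPr oS) => <-.
rewrite -sum1_card [RHS]big_mkcond /=.
by apply: eq_bigr => b _; rewrite !in_setD inE andbC; case: (_ && _).
Qed.

Lemma aut_card_le_NumOccurs n (s : assign B n) : (0 < NumOccursCov phiV phiD s)%N ->
  (c <= NumOccursCov phiV phiD s)%N.
Proof.
rewrite NumOccursCovE // => /card_gt0P[a]; rewrite inE => oa.
rewrite /c -(card_aut_orbit Het (a := a)); last by case/andP: oa.
by apply: subset_leq_card; apply/subsetP => b; rewrite inE; apply: occ_aut_orbit.
Qed.

(* With [X = N / c >= 1], this is [X - 1 <= N * (N - c)]. *)
Lemma occurs_indicator n (s : assign B n) :
  `| (0 < NumOccursCov phiV phiD s)%N%:R - (NumOccursCov phiV phiD s)%:R / c%:R |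
    <= (distinct_pairs s)%:R :> rat.
Proof.
rewrite distinct_pairsE; have := @aut_card_le_NumOccurs n s.
have : (1 <= c)%N by apply: aut_card_gt0.
case: (NumOccursCov phiV phiD s) => [|N] c1 /=.
  by rewrite mul0r subr0 normr0 mul0n.
move=> /(_ isT) cN; have c1' : 1 <= c%:R :> rat by rewrite ler1n.
have cN' : c%:R <= N.+1%:R :> rat by rewrite ler_nat.
have -> : 1 - N.+1%:R / c%:R = - ((N.+1%:R - c%:R) / c%:R) :> rat.
  by rewrite mulrBl divff ?opprB // gt_eqF // (lt_le_trans ltr01).
rewrite normrN ger0_norm; last by rewrite divr_ge0 ?ler0n // subr_ge0.
rewrite natrM natrB // ler_pdivrMr ?(lt_le_trans ltr01) //.
have d0 : 0 <= N.+1%:R - c%:R :> rat by rewrite subr_ge0.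
have N1 : 1 <= N.+1%:R * c%:R :> rat by rewrite -natrM ler1n; nia.
by rewrite mulrAC -[leLHS]mul1r ler_wpM2r.
Qed.

Lemma prob_vs_expect n :
  `|prob_occurs phiV phiD n - expect_occ phiV phiD n / c%:R|
    <= (\sum_(s : assign B n) (distinct_pairs s)%:R) / #|{: assign B n}|%:R.
Proof.
have -> : prob_occurs phiV phiD n =
    (\sum_(s : assign B n) (0 < NumOccursCov phiV phiD s)%N%:R) / #|{: assign B n}|%:R.
  congr (_ / _); rewrite -sum1_card natr_sum big_mkcond /=.
  by apply: eq_bigr => s _; rewrite inE; case: (0 < _)%N.
rewrite /expect_occ mulrAC -mulrBl normrM [`|_^-1|]ger0_norm ?invr_ge0 ?ler0n //.
rewrite ler_wpM2r ?invr_ge0 ?ler0n // mulr_suml -sumrB.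
apply: le_trans (ler_norm_sum _ _ _) _; apply: ler_sum => s _.
exact: occurs_indicator.
Qed.

(** A pair [(a, b)] has probability at most [2 * n ^- (#|F|./2)], and [occ_overlap] bounds this by
    [2 * n ^ (- r - 1)] times [n] to the power minus the number of vertices covered.
    [sum_image_weight], for the index set of two copies of the vertices of [psi], sums these
    weights. *)
Lemma expect_distinct_pairs n :
  pruned psi -> (forall u : gV psi, 1 <= comp_ord u) ->
  (0 < n)%N -> (2 * (2 * K) ^ 2 <= n)%N ->
  (\sum_(s : assign B n) (distinct_pairs s)%:R) / #|{: assign B n}|%:R
    <= 2 * ((v + v) ^ (v + v))%:R * n%:R ^ (- ord psi - 1) :> rat.
Proof.
move=> pr op n0 Kn; have nz : n%:R != 0 :> rat by rewrite pnatr_eq0 -lt0n.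
have n1 : 1 <= n%:R :> rat by rewrite ler1n.
pose pairT := ({ffun gV psi -> 'I_n} * {ffun gV psi -> 'I_n})%type.
pose l (ab : pairT) (i : gV psi + gV psi) :=
  match i with inl u => ab.1 u | inr u => ab.2 u end.
pose g (i : gV psi + gV psi) := match i with inl u => phiV u | inr u => phiV u end.
have l_inj x y : l x =1 l y -> x = y.
  case: x y => [a b] [a' b'] h; congr pair; apply/ffunP => u.
    exact: (h (inl u)).
  exact: (h (inr u)).
have lW a b : [set (g i, l (a, b) i) | i : gV psi + gV psi] = verts2 phiV a b.
  apply/setP => z; rewrite inE; apply/imsetP/orP.
    by case=> -[] u _ ->; [left|right]; apply/imsetP; exists u.
  by case=> /imsetP[u _ ->]; [exists (inl u) | exists (inr u)].
have := sum_image_weight g n0 l_inj; rewrite card_sum -/v => sumW.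
rewrite mulrAC -natr_sum /distinct_pairs exchange_big /= natr_sum mulr_suml.
have t0 : 0 <= 2 * n%:R ^ (- ord psi - 1) :> rat.
  by rewrite mulr_ge0 // exprz_ge0 ?ler0n.
apply: le_trans (ler_wpM2l t0 sumW); rewrite mulr_sumr; apply: ler_sum => -[a b] _ /=.
rewrite lW; pose P (s : assign B n) :=
  [&& occ phiV phiD s a, occ phiV phiD s b & b \notin aut_orbit phiV phiD a].
rewrite [X in X%:R / _](_ : _ = #|[set s | P s]|); last first.
  rewrite -sum1_card [RHS]big_mkcond /=; apply: eq_bigr => s _.
  by rewrite inE /P; case: (_ && _).
have w0 : 0 <= n%:R ^- #|verts2 phiV a b| :> rat by rewrite invr_ge0 exprn_ge0 ?ler0n.
(* A pair that never occurs contributes 0; otherwise a cover [s0] containing both occurrences shows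
   that their joint demands are consistent. *)
case: (set_0Vmem [set s | P s]) => [->|[s0]].
  by rewrite cards0 mul0r mulr_ge0.
rewrite inE => /and3P[oa ob nab].
set F := arcs phiD a :|: arcs phiD b.
have Frev x : (dart_rev x \in F) = (x \in F) by rewrite !in_setU !(arcs_rev Hmorph).
have Fsat s : occ phiV phiD s a -> occ phiV phiD s b -> s \in assign_sat F.
  move=> /andP[_]; rewrite inE => /forall_inP ha /andP[_]; rewrite inE => /forall_inP hb.
  by rewrite inE; apply/forall_inP => x; rewrite in_setU => /orP[/ha|/hb].
have Fperm e : exists p, perm_sat (fibre F e) p.
  exists (val s0 e); apply/forall_inP => ij; rewrite inE => ijF.
  by have := Fsat _ oa ob; rewrite inE => /forall_inP /(_ _ ijF).
have evD : #|gD psi| = (2 * K)%N.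
  by have := card_darts_even psi; rewrite /K => evD; lia.
have FleK : (#|F|./2 <= 2 * K)%N.
  have : (#|F| <= #|arcs phiD a| + #|arcs phiD b|)%N by rewrite cardsU leq_subr.
  by case/andP: oa => va _; case/andP: ob => vb _; rewrite !(card_arcs Hmorph) // evD; lia.
have Kn' : (2 * #|F|./2 ^ 2 <= n)%N.
  by apply: leq_trans Kn; rewrite leq_mul // leq_exp2r.
have evF : #|F| = (2 * #|F|./2)%N.
  have revK : involutive (@dart_rev B n) by case=> e [i j]; rewrite /dart_rev /= ginvK.
  have rev_nofix x : @dart_rev B n x != x.
    by apply: contraTneq isT => /(congr1 fst) /= e; have := ginv_nofix x.1; rewrite e eqxx.
  by rewrite (card_involution_closed revK rev_nofix Frev) doubleK mul2n.
have := occ_overlap Hmorph Het pr op oa ob nab; rewrite -/F evF evD -/v => ov.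
apply: (@le_trans _ _ (#|assign_sat F|%:R / #|{: assign B n}|%:R)).
  rewrite ler_wpM2r ?invr_ge0 ?ler0n // ler_nat; apply: subset_leq_card.
  apply/subsetP => s; rewrite inE => /and3P[oa' ob' _].
  exact: Fsat.
apply: le_trans (sat_ratio_le Frev Fperm n0 Kn') _.
rewrite -mulrA; apply: ler_pM.
- by rewrite addr_ge0 ?divr_ge0 ?ler0n.
- by rewrite invr_ge0 exprn_ge0 ?ler0n.
(* Since [#|F|./2 <= 2 * K], the assumption on [n] bounds the correction factor by 2. *)
- suff : (2 * #|F|./2 ^ 2)%:R / n%:R <= 1 :> rat by lra.
  by rewrite ler_pdivrMr ?ltr0n // mul1r ler_nat.
rewrite !exprnN -expfzDr //; apply: ler_weXz2l => //.
by rewrite ordE; move: ov; clear; clearbody v K; move: (#|F|./2) #|verts2 _ _ _|; lia.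
Qed.

End Moments.

Theorem theorem2p51 (B psi : graph) (phiV : gV psi -> gV B) (phiD : gD psi -> gD B)
    (Hmorph : is_morph phiV phiD) (Het : etale phiD) :
  let r := ord psi in
  (exists (C : rat) (N : nat), forall n : nat, (N <= n)%N ->
     `|expect_occ phiV phiD n - (n%:R : rat) ^ (- r)| <= C * (n%:R : rat) ^ (- r - 1))
  /\
  (exists (C : rat) (N : nat), forall n : nat, (N <= n)%N ->
     prob_occurs phiV phiD n <= (n%:R : rat) ^ (- r) + C * (n%:R : rat) ^ (- r - 1))
  /\
  (pruned psi -> (forall v : gV psi, 1 <= comp_ord v) ->
   exists (C : rat) (N : nat), forall n : nat, (N <= n)%N ->
     `|prob_occurs phiV phiD n - (n%:R : rat) ^ (- r) / (aut_card phiV phiD)%:R|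
       <= C * (n%:R : rat) ^ (- r - 1)).
Proof.
move=> r; set v := #|gV psi|; set K := #|gD psi|./2.
pose C := (v * v + 2 * K ^ 2)%:R : rat.
(* Large enough for [0 < n], [v <= n] and [2 * (2 * K) ^ 2 <= n]; the last also gives the weaker
   [2 * K ^ 2 <= n] used for the expectation. *)
pose N := (1 + 2 * (2 * K) ^ 2 + v)%N.
have asymp n : (N <= n)%N ->
    `|expect_occ phiV phiD n - n%:R ^ (- r)| <= C * n%:R ^ (- r - 1).
  by move=> Nn; apply: expect_occ_asymp; rewrite // -?/v -?/K; move: Nn; rewrite /N; nia.
split; first by exists C, N.
split.
  exists C, N => n /asymp; rewrite ler_norml => /andP[_].
  by have := prob_le_expect phiV phiD n; lra.
(* Triangle inequality through the expectation divided by [c]: the first summand bounds the pairs in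
   distinct orbits, and [C] bounds the error of the expectation, which division by [c >= 1] does not
   increase. *)
move=> pr op; exists (2 * ((v + v) ^ (v + v))%:R + C), N => n Nn.
set c := (aut_card phiV phiD)%:R.
have c1 : 1 <= c by rewrite ler1n aut_card_gt0.
have h1 := prob_vs_expect Hmorph Het n.
have h2 : `|expect_occ phiV phiD n / c - n%:R ^ (- r) / c| <= C * n%:R ^ (- r - 1).
  rewrite -mulrBl normrM [`|c^-1|]ger0_norm ?invr_ge0 ?(le_trans ler01) //.
  apply: le_trans (asymp _ Nn); rewrite ler_piMr //.
  by rewrite invf_le1 // (lt_le_trans ltr01).
have n0 : (0 < n)%N by move: Nn; rewrite /N; lia.
have Kn : (2 * (2 * K) ^ 2 <= n)%N by move: Nn; rewrite /N; lia.
have h3 := expect_distinct_pairs Hmorph Het pr op n0 Kn.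
rewrite mulrDl; apply: le_trans (lerD (le_trans h1 h3) h2).
by apply: le_trans (ler_normD _ _); rewrite addrA subrK.
Qed.
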